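(* For all $M \in \mathbb{N}=\{1,2,3,\dots\}$ and all $x\in\mathbb{R}$, $$\left| V_M(x) - s(x) \right| \leq \min\left( \frac{1}{2},\ \frac{\pi^4 + 10 \pi^2 + 15}{480\pi} \cdot \frac{1}{M^3 \lVert x \rVert_{S^1}^3} \right),$$ where for $x\in\mathbb{Z}$ the second term in the minimum is interpreted as $+\infty$.
   Context: $\lVert x\rVert_{S^1}$ denotes the distance from $x$ to the nearest integer. The sawtooth function is $s(x)=\{x\}-1/2$ for $x\notin\mathbb{Z}$ (with $\{x\}$ the fractional part) and $s(x)=0$ for $x\in\mathbb{Z}$. The Fej\'er kernel is $\Delta_M(x) = \frac{1}{M} \left( \frac{\sin \pi M x}{\sin \pi x} \right)^2$ (extended continuously to integers). The Vaaler polynomial is $$V_M(x) = \frac{1}{M + 1} \sum_{k = 1}^M \left( \frac{k}{M + 1} - \frac{1}{2} \right) \Delta_{M + 1} \left( x - \frac{k}{M + 1} \right) + \frac{1}{2\pi(M + 1)} \sin\left(2\pi(M + 1)x \right) - \frac{1}{2\pi} \Delta_{M + 1}\left( x \right) \sin (2 \pi x).$$ *)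

(* Defs.v *)
From Stdlib Require Import Reals.
From Coquelicot Require Import Coquelicot.
Local Open Scope R_scope.

(* The infimum is attained, hence finite, so [real] loses nothing. *)
Definition dist_nearest_int (x : R) : R :=
  real (Glb_Rbar (fun d : R => exists n : Z, d = Rabs (x - IZR n))).

(* In the definitions below, [frac_part x = 0] says that x is an integer. *)

Definition sawtooth (x : R) : R :=
  if Req_dec_T (frac_part x) 0 then 0 else frac_part x - 1 / 2.

(* The value M at the integers is the continuous extension of the quotient. *)
Definition fejer (M : nat) (x : R) : R :=
  if Req_dec_T (frac_part x) 0 then INR M
  else 1 / INR M * (sin (PI * INR M * x) / sin (PI * x)) ^ 2.

Definition vaaler (M : nat) (x : R) : R :=
  1 / INR (M + 1) *
    sum_n_m (fun k : nat =>
               (INR k / INR (M + 1) - 1 / 2)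
               * fejer (M + 1) (x - INR k / INR (M + 1))) 1 M
  + 1 / (2 * PI * INR (M + 1)) * sin (2 * PI * INR (M + 1) * x)
  - 1 / (2 * PI) * fejer (M + 1) x * sin (2 * PI * x).

(* Division by zero is a finite real in Rocq, so the value +oo at the integers
   has to be imposed explicitly. *)
Definition tail_bound (M : nat) (x : R) : Rbar :=
  if Req_dec_T (frac_part x) 0 then p_infty
  else Finite ((PI ^ 4 + 10 * PI ^ 2 + 15) / (480 * PI)
               * (1 / (INR M ^ 3 * dist_nearest_int x ^ 3))).

(* Main.v *)
Require Import Defs.
From Stdlib Require Import Reals ZArith Lra Lia.
From Coquelicot Require Import Coquelicot.
Local Open Scope R_scope.

(** Put [N = M + 1], [t = pi x] with [0 < x < 1], [S = sin (N t)] and consider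
    [ker u = u / sin^2 u - cot u], whose primitive is [ker_prim u = - u cot u].
    The identities [S^2 sum_k csc^2 (t - k pi/N) = N^2] and
    [S^2 sum_k cot (t - k pi/N) = N S cos (N t)], summed over [0 <= k < N], turn
    [V_M x - s x] into [- S^2 / (pi^2 N)] times the error of the trapezoidal rule
    for [ker] on [[t - pi, t]] with step [pi/N], unless [N x] is an integer, when
    [V_M x = s x].
    As [ker] is odd and increasing, the error is at most half a step times
    [ker t - ker (t - pi) = pi / sin^2 t], which gives the bound [1/2].
    As [ker] is convex on [(0, pi)] and concave on [(-pi, 0)], the error is also
    at most an eighth of the squared step times the variation of [ker'], which
    gives [1 / (8 N^3 m^3)] with [m] the distance from [x] to the integers; and
    [1/8] is less than the constant in the statement. *)

(** * Trigonometric inequalities *)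

Lemma derive_nonneg_le (f df : R -> R) (a b : R) :
  a <= b ->
  (forall t, a <= t <= b -> is_derive f t (df t)) ->
  (forall t, a <= t <= b -> 0 <= df t) ->
  f a <= f b.
Proof.
  intros Hab Hd Hp.
  destruct (MVT_gen f a b df) as [c [Hc E]].
  - intros t Ht. rewrite Rmin_left, Rmax_right in Ht by lra. apply Hd; lra.
  - intros t Ht. rewrite Rmin_left, Rmax_right in Ht by lra.
    apply continuity_pt_filterlim, (ex_derive_continuous f). eexists; apply Hd; lra.
  - rewrite Rmin_left, Rmax_right in Hc by lra.
    assert (0 <= df c * (b - a)) by (apply Rmult_le_pos; [apply Hp; lra | lra]). lra.
Qed.

Lemma mul_cos_le_sin (t : R) : 0 <= t <= PI -> t * cos t <= sin t.
Proof.
  intros Ht.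
  enough (sin 0 - 0 * cos 0 <= sin t - t * cos t) by (rewrite sin_0 in *; lra).
  apply (derive_nonneg_le (fun u => sin u - u * cos u) (fun u => u * sin u)).
  - lra.
  - intros u _. auto_derive; [easy | ring].
  - intros u Hu. apply Rmult_le_pos; [lra | apply sin_ge_0; lra].
Qed.

(** With double angles this is [3 sin (2t) <= 2t (2 + cos (2t))], the Cusa-Huygens inequality at
    [2t]. Up to a positive factor the difference of its sides is the derivative of [ker_deriv], so
    it makes [ker] convex on [(0, PI)]. *)
Lemma cusa_huygens (t : R) :
  0 <= t <= PI -> 3 * (sin t * cos t) <= t * (1 + 2 * cos t ^ 2).
Proof.
  intros Ht.
  enough (0 * (1 + 2 * cos 0 ^ 2) - 3 * (sin 0 * cos 0)
          <= t * (1 + 2 * cos t ^ 2) - 3 * (sin t * cos t)) by (rewrite sin_0 in *; lra).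
  apply (derive_nonneg_le (fun u => u * (1 + 2 * cos u ^ 2) - 3 * (sin u * cos u))
                          (fun u => 4 * (sin u * (sin u - u * cos u)))).
  - lra.
  - intros u _. auto_derive; [easy|]. pose proof (sin2_cos2 u) as E; unfold Rsqr in E.
    lra.
  - intros u Hu. apply Rmult_le_pos; [lra|]. apply Rmult_le_pos.
    + apply sin_ge_0; lra.
    + pose proof (mul_cos_le_sin u). lra.
Qed.

(** The quotient [sin u / u] decreases on [(0, PI / 2]], so it is at least its value [2 / PI] at the
    right end. *)
Lemma jordan (t : R) : 0 < t <= PI / 2 -> 2 * t / PI <= sin t.
Proof.
  intros Ht. pose proof PI_RGT_0 as HPI.
  assert (H : - (sin t / t) <= - (sin (PI / 2) / (PI / 2))).
  { apply (derive_nonneg_le (fun u => - (sin u / u)) (fun u => (sin u - u * cos u) / u ^ 2)).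
    - lra.
    - intros u Hu. auto_derive; [lra | field; lra].
    - intros u Hu. apply Rdiv_le_0_compat; [| nra].
      pose proof (mul_cos_le_sin u). lra. }
  rewrite sin_PI2 in H.
  replace (2 * t / PI) with (t * (1 / (PI / 2))) by (field; lra).
  replace (sin t) with (t * (sin t / t)) by (field; lra).
  apply Rmult_le_compat_l; lra.
Qed.

Lemma Rabs_sin_mul_le (n : nat) (t : R) : Rabs (sin (INR n * t)) <= INR n * Rabs (sin t).
Proof.
  induction n as [|n IH].
  - simpl. rewrite !Rmult_0_l, sin_0, Rabs_R0. lra.
  - rewrite S_INR. replace ((INR n + 1) * t) with (INR n * t + t) by ring.
    rewrite sin_plus. eapply Rle_trans; [apply Rabs_triang|]. rewrite !Rabs_mult.
    assert (Rabs (cos t) <= 1) by (apply Rabs_le; pose proof (COS_bound t); lra).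
    assert (Rabs (cos (INR n * t)) <= 1)
      by (apply Rabs_le; pose proof (COS_bound (INR n * t)); lra).
    pose proof (Rabs_pos (sin (INR n * t))). pose proof (Rabs_pos (sin t)).
    pose proof (Rabs_pos (cos t)). pose proof (Rabs_pos (cos (INR n * t))). nra.
Qed.

(** * The kernel and its primitive *)

Definition ker (t : R) : R := t / sin t ^ 2 - cos t / sin t.
Definition ker_prim (t : R) : R := - (t * cos t / sin t).
Definition ker_deriv (t : R) : R := 2 * (sin t - t * cos t) / sin t ^ 3.

Lemma is_derive_ker_prim (t : R) : sin t <> 0 -> is_derive ker_prim t (ker t).
Proof.
  intros H. unfold ker_prim, ker. auto_derive; [easy|].
  pose proof (sin2_cos2 t) as E; unfold Rsqr in E.
  (* The last summand vanishes by the Pythagorean identity. With it the first equality is rational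
     in [sin t] and [cos t], within reach of [field]; the same device recurs below. *)
  transitivity (t / sin t ^ 2 - cos t / sin t + t * (sin t * sin t + cos t * cos t - 1) / sin t ^ 2).
  - field; easy.
  - rewrite E. field; easy.
Qed.

Lemma is_derive_ker (t : R) : sin t <> 0 -> is_derive ker t (ker_deriv t).
Proof.
  intros H. unfold ker_deriv, ker. auto_derive; [repeat split; now try apply (pow_nonzero _ 2)|].
  pose proof (sin2_cos2 t) as E; unfold Rsqr in E.
  transitivity (2 * (sin t - t * cos t) / sin t ^ 3 + 1 * (sin t * sin t + cos t * cos t - 1) / sin t ^ 2).
  - field; easy.
  - rewrite E. field; easy.
Qed.

Lemma ker_opp (t : R) : sin t <> 0 -> ker (- t) = - ker t.
Proof. intros H. unfold ker. rewrite sin_neg, cos_neg. field; easy. Qed.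

Lemma ker_prim_opp (t : R) : sin t <> 0 -> ker_prim (- t) = ker_prim t.
Proof. intros H. unfold ker_prim. rewrite sin_neg, cos_neg. field; easy. Qed.

Lemma ker_deriv_opp (t : R) : sin t <> 0 -> ker_deriv (- t) = ker_deriv t.
Proof. intros H. unfold ker_deriv. rewrite sin_neg, cos_neg. field; easy. Qed.

Lemma ker_deriv_ge0 (t : R) : 0 < t < PI -> 0 <= ker_deriv t.
Proof.
  intros Ht. pose proof (sin_gt_0 t (proj1 Ht) (proj2 Ht)).
  pose proof (mul_cos_le_sin t). apply Rdiv_le_0_compat; [lra | apply pow_lt; lra].
Qed.

Lemma ker_le (a b : R) : 0 < a <= b -> b < PI -> ker a <= ker b.
Proof.
  intros Ha Hb. apply (derive_nonneg_le ker ker_deriv); [lra| |].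
  - intros t Ht. apply is_derive_ker, Rgt_not_eq, sin_gt_0; lra.
  - intros t Ht. apply ker_deriv_ge0; lra.
Qed.

Lemma ker_deriv_le (a b : R) : 0 < a <= b -> b < PI -> ker_deriv a <= ker_deriv b.
Proof.
  intros Ha Hb.
  apply (derive_nonneg_le ker_deriv
    (fun t => 2 * (t * (1 + 2 * cos t ^ 2) - 3 * (sin t * cos t)) / sin t ^ 4)); [lra| |].
  - intros t Ht. assert (sin t <> 0) by (apply Rgt_not_eq, sin_gt_0; lra).
    unfold ker_deriv. auto_derive; [now apply (pow_nonzero _ 3)|].
    pose proof (sin2_cos2 t) as E; unfold Rsqr in E.
    transitivity (2 * (t * (1 + 2 * cos t ^ 2) - 3 * (sin t * cos t)) / sin t ^ 4
                  + 2 * t * (sin t * sin t + cos t * cos t - 1) / sin t ^ 4).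
    + field; easy.
    + rewrite E. field; easy.
  - intros t Ht. pose proof (cusa_huygens t).
    apply Rdiv_le_0_compat; [lra | apply pow_lt, sin_gt_0; lra].
Qed.

Lemma ker_ge0 (t : R) : 0 < t < PI -> 0 <= ker t.
Proof.
  intros Ht. pose proof (sin_gt_0 t (proj1 Ht) (proj2 Ht)).
  replace (ker t) with ((t - sin t * cos t) / sin t ^ 2) by (unfold ker; field; lra).
  apply Rdiv_le_0_compat; [| apply pow_lt; lra].
  pose proof (sin_lt_x t). pose proof (COS_bound t). nra.
Qed.

(** On [(0, PI / 2]] the difference [t - ker t] is a product of nonnegative factors over
    [sin t ^ 2]. The lemma bounds the variation of [ker] over a panel around 0 by the width of that
    panel. *)
Lemma ker_le_id (t : R) : 0 < t <= PI / 2 -> ker t <= t.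
Proof.
  intros Ht. pose proof PI_RGT_0. assert (0 < sin t) by (apply sin_gt_0; lra).
  assert (E : t - ker t = (sin t - t * cos t) * cos t / sin t ^ 2).
  { unfold ker. pose proof (sin2_cos2 t) as E; unfold Rsqr in E.
    transitivity ((sin t - t * cos t) * cos t / sin t ^ 2
                  + t * (sin t * sin t + cos t * cos t - 1) / sin t ^ 2).
    - field; lra.
    - rewrite E. field; lra. }
  enough (0 <= t - ker t) by lra. rewrite E.
  apply Rdiv_le_0_compat; [|apply pow_lt; lra].
  pose proof (mul_cos_le_sin t). pose proof (cos_ge_0 t). apply Rmult_le_pos; lra.
Qed.

(** * Trapezoidal rule on one panel *)

(** The integral is written through [ker_prim], which has a removable singularity at 0. Since
    [is_derive_ker_prim] does not apply at 0, a panel around 0 needs its own argument. *)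
Definition panel_err (a b : R) : R :=
  (b - a) * (ker a + ker b) / 2 - (ker_prim b - ker_prim a).

(** These are the rectangle rules for the increasing function [ker]. Their mean is the trapezoidal
    value, so the trapezoidal error is at most half the width times the variation of [ker]. *)
Lemma ker_prim_sub_bounds (a b : R) :
  0 < a <= b -> b < PI ->
  (b - a) * ker a <= ker_prim b - ker_prim a <= (b - a) * ker b.
Proof.
  intros Ha Hb.
  assert (Hd : forall t, a <= t <= b -> is_derive ker_prim t (ker t))
    by (intros t Ht; apply is_derive_ker_prim, Rgt_not_eq, sin_gt_0; lra).
  split.
  - enough (ker_prim a - a * ker a <= ker_prim b - b * ker a) by lra.
    apply (derive_nonneg_le (fun t => ker_prim t - t * ker a) (fun t => ker t - ker a)); [lra| |].
    + intros t Ht. apply (is_derive_minus ker_prim); [now apply Hd|].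
      auto_derive; [easy | ring].
    + intros t Ht. pose proof (ker_le a t). lra.
  - enough (a * ker b - ker_prim a <= b * ker b - ker_prim b) by lra.
    apply (derive_nonneg_le (fun t => t * ker b - ker_prim t) (fun t => ker b - ker t)); [lra| |].
    + intros t Ht. apply (is_derive_minus _ ker_prim); [|now apply Hd].
      auto_derive; [easy | ring].
    + intros t Ht. pose proof (ker_le t b). lra.
Qed.

(* The error over [[c - r, c + r]] has [r]-derivative [r * (ker_deriv (c + r) - ker_deriv (c - r))]. *)
Lemma panel_err_pos (a b : R) :
  0 < a <= b -> b < PI ->
  0 <= panel_err a b <= (b - a) ^ 2 / 8 * (ker_deriv b - ker_deriv a).
Proof.
  intros Ha Hb.
  set (c := (a + b) / 2). set (h := (b - a) / 2). set (K := ker_deriv b - ker_deriv a).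
  set (E := fun r => r * (ker (c + r) + ker (c - r)) - (ker_prim (c + r) - ker_prim (c - r))).
  set (dE := fun r => r * (ker_deriv (c + r) - ker_deriv (c - r))).
  assert (Hc : a = c - h /\ b = c + h) by (unfold c, h; split; field).
  assert (Hh : 0 <= h) by (unfold h; lra).
  assert (HdE : forall r, 0 <= r <= h -> is_derive E r (dE r)).
  { intros r Hr.
    assert (sin (c + r) <> 0) by (apply Rgt_not_eq, sin_gt_0; lra).
    assert (sin (c - r) <> 0) by (apply Rgt_not_eq, sin_gt_0; lra).
    pose proof (is_derive_ker (c + r)) as D1. pose proof (is_derive_ker (c - r)) as D2.
    pose proof (is_derive_ker_prim (c + r)) as D3. pose proof (is_derive_ker_prim (c - r)) as D4.
    unfold Rminus in D2, D4. unfold E, dE. auto_derive.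
    - repeat split; eexists; eauto.
    - rewrite (is_derive_unique (fun x : R => ker x) _ _ (D1 H)),
        (is_derive_unique (fun x : R => ker x) _ _ (D2 H0)),
        (is_derive_unique (fun x : R => ker_prim x) _ _ (D3 H)),
        (is_derive_unique (fun x : R => ker_prim x) _ _ (D4 H0)). unfold Rminus. ring. }
  assert (HK : forall r, 0 <= r <= h -> 0 <= dE r <= r * K).
  { intros r Hr. unfold dE, K.
    pose proof (ker_deriv_le (c - r) (c + r)). pose proof (ker_deriv_le a (c - r)).
    pose proof (ker_deriv_le (c + r) b). split.
    - apply Rmult_le_pos; lra.
    - apply Rmult_le_compat_l; lra. }
  assert (E0 : E 0 = 0) by (unfold E; rewrite Rplus_0_r, Rminus_0_r; ring).
  assert (Eh : E h = panel_err a b)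
    by (unfold E, panel_err; rewrite <- (proj1 Hc), <- (proj2 Hc); unfold h; field).
  rewrite <- Eh. split.
  - rewrite <- E0. apply (derive_nonneg_le E dE); [lra | easy | apply HK].
  (* Integrating [dE r <= r * K] up to [h] gives [h ^ 2 / 2 * K]; as [h] is half the width, this is
     where the 8 comes from. *)
  - enough (0 ^ 2 / 2 * K - E 0 <= h ^ 2 / 2 * K - E h)
      by (replace ((b - a) ^ 2 / 8 * K) with (h ^ 2 / 2 * K) by (unfold h; field); lra).
    apply (derive_nonneg_le (fun r => r ^ 2 / 2 * K - E r) (fun r => r * K - dE r)); [lra| |].
    + intros r Hr. apply (is_derive_minus _ E); [|now apply HdE].
      auto_derive; [easy | field].
    + intros r Hr. pose proof (HK r Hr). lra.
Qed.

Lemma panel_err_opp (a b : R) :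
  sin a <> 0 -> sin b <> 0 -> panel_err (- b) (- a) = - panel_err a b.
Proof.
  intros Ha Hb. unfold panel_err. rewrite !ker_opp, !ker_prim_opp by easy. field.
Qed.

(* [ker_prim t = t * ker t - (t / sin t) ^ 2] and [p cot p <= 1 <= (q / sin q) ^ 2]. *)
Lemma ker_prim_sub_le_straddle (p q : R) :
  0 < p < PI -> 0 < q < PI -> ker_prim q - ker_prim p <= (p + q) * ker q.
Proof.
  intros Hp Hq.
  assert (Sp : 0 < sin p) by (apply sin_gt_0; lra).
  assert (Sq : 0 < sin q) by (apply sin_gt_0; lra).
  assert (E : ker_prim q = q * ker q - (q / sin q) ^ 2)
    by (unfold ker_prim, ker; field; lra).
  assert (1 <= q / sin q).
  { apply Rle_div_r; [lra|]. pose proof (sin_lt_x q). lra. }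
  assert (- ker_prim p <= 1).
  { unfold ker_prim. rewrite Ropp_involutive. apply Rle_div_l; [lra|].
    pose proof (mul_cos_le_sin p). lra. }
  assert (0 <= p * ker q) by (apply Rmult_le_pos; [lra | now apply ker_ge0]).
  nra.
Qed.

(* The constant 2 pays for the panel that contains 0. *)
Definition signed_deriv (t : R) : R :=
  if Rlt_dec 0 t then ker_deriv t + 2 else - (ker_deriv t + 2).

(** Each bound contains the increment of one function over the panel, so that it telescopes over
    consecutive panels of equal width. [signed_deriv] changes sign at 0 because [ker_deriv] is even
    and increases on [(0, PI)]. *)
Lemma panel_err_bounds (a b : R) :
  - PI < a -> a <= b -> b < PI -> a <> 0 -> b <> 0 -> b - a <= PI / 2 ->
  Rabs (panel_err a b) <= (b - a) * (ker b - ker a) / 2 /\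
  Rabs (panel_err a b) <= (b - a) ^ 2 / 8 * (signed_deriv b - signed_deriv a).
Proof.
  intros Ha Hab Hb Ha0 Hb0 Hw. pose proof PI_RGT_0 as HPI.
  unfold signed_deriv.
  destruct (Rlt_dec 0 a) as [Ha1|Ha1]; [|destruct (Rlt_dec 0 b) as [Hb1|Hb1]].
  - destruct (Rlt_dec 0 b); [|lra].
    pose proof (ker_prim_sub_bounds a b). pose proof (panel_err_pos a b). split.
    + unfold panel_err. apply Rabs_le. lra.
    + rewrite Rabs_pos_eq by lra. lra.
  (* The panel contains 0. The straddling inequality, used in both directions, gives the first
     bound. By [ker_le_id] that bound is at most [(b - a) ^ 2 / 2], which the jump [2 + 2] of
     [signed_deriv] covers. *)
  - assert (Sa : 0 < sin (- a)) by (apply sin_gt_0; lra).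
    assert (Sb : 0 < sin b) by (apply sin_gt_0; lra).
    pose proof (ker_prim_sub_le_straddle (- a) b) as H1.
    pose proof (ker_prim_sub_le_straddle b (- a)) as H2.
    pose proof (ker_le_id (- a)) as H3. pose proof (ker_le_id b) as H4.
    pose proof (ker_deriv_ge0 (- a)) as H5. pose proof (ker_deriv_ge0 b) as H6.
    assert (S : sin a <> 0) by (rewrite sin_neg in Sa; lra).
    rewrite ker_opp in H2, H3 by easy.
    rewrite ker_prim_opp in H1, H2 by easy. rewrite ker_deriv_opp in H5 by easy.
    assert (H : Rabs (panel_err a b) <= (b - a) * (ker b - ker a) / 2)
      by (unfold panel_err; apply Rabs_le; lra).
    split; [exact H|]. apply (Rle_trans _ _ _ H).
    assert ((b - a) * (ker b - ker a) <= (b - a) * (b - a)) by (apply Rmult_le_compat_l; lra).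
    assert (0 <= (b - a) ^ 2 * (ker_deriv a + ker_deriv b))
      by (apply Rmult_le_pos; [apply pow2_ge_0 | lra]).
    lra.
  (* A panel to the left of 0 is reflected to the right, where the error changes sign. *)
  - assert (Sa : 0 < sin (- a)) by (apply sin_gt_0; lra).
    assert (Sb : 0 < sin (- b)) by (apply sin_gt_0; lra).
    pose proof (ker_prim_sub_bounds (- b) (- a)) as H1.
    pose proof (panel_err_pos (- b) (- a)) as H2.
    assert (S1 : sin a <> 0) by (rewrite sin_neg in Sa; lra).
    assert (S2 : sin b <> 0) by (rewrite sin_neg in Sb; lra).
    rewrite panel_err_opp, !ker_deriv_opp in H2 by easy.
    rewrite !ker_opp, !ker_prim_opp in H1 by easy.
    split.
    + unfold panel_err. apply Rabs_le. lra.
    + rewrite Rabs_left1 by lra. lra.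
Qed.

(** * Sums over equispaced nodes *)

Lemma sum_n_linear (f g h : nat -> R) (a b : R) (n : nat) :
  (forall k, (k <= n)%nat -> h k = a * f k + b * g k) ->
  sum_n h n = a * sum_n f n + b * sum_n g n :> R.
Proof.
  intros H. induction n as [|n IH].
  - rewrite !sum_O. now apply H.
  - rewrite !sum_Sn. change plus with Rplus. rewrite IH, H by auto. ring.
Qed.

(** Telescoping of [2 sin b sin u = cos (u - b) - cos (u + b)]. *)
Lemma sum_sin_arith (t b : R) (n : nat) :
  2 * sin b * sum_n (fun k => sin (t - 2 * INR k * b)) n
  = cos (t - (2 * INR n + 1) * b) - cos (t + b).
Proof.
  induction n as [|n IH].
  - rewrite sum_O. simpl INR. rewrite Rmult_0_r, !Rmult_0_l, Rminus_0_r, Rplus_0_l, Rmult_1_l.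
    rewrite cos_minus, cos_plus. ring.
  - rewrite sum_Sn. change plus with Rplus. rewrite Rmult_plus_distr_l, IH, S_INR.
    set (u := t - 2 * (INR n + 1) * b).
    replace (t - (2 * INR n + 1) * b) with (u + b) by (unfold u; ring).
    replace (t - (2 * (INR n + 1) + 1) * b) with (u - b) by (unfold u; ring).
    rewrite cos_minus, cos_plus. ring.
Qed.

Definition node (M : nat) (t : R) (k : nat) : R := t - INR k * (PI / INR (S M)).

Lemma INR_S_pos (M : nat) : 0 < INR (S M).
Proof. apply lt_0_INR. lia. Qed.

(** Over a full set of nodes the two cosines in [sum_sin_arith] differ by the phase [2 j PI], and
    [sin b] is nonzero because [0 < j < S M]. The shift [c] lets the cosine sum follow with
    [c = PI / 2]. *)
Lemma sum_sin_node_add (M j : nat) (t c : R) :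
  (1 <= j <= M)%nat -> sum_n (fun k => sin (2 * INR j * node M t k + c)) M = 0 :> R.
Proof.
  intros Hj. pose proof (INR_S_pos M) as HN. pose proof PI_RGT_0 as HPI.
  set (b := INR j * (PI / INR (S M))).
  assert (Hb : 0 < sin b).
  { assert (0 < INR j) by (apply lt_0_INR; lia).
    assert (INR j < INR (S M)) by (apply lt_INR; lia).
    apply sin_gt_0; unfold b.
    - apply Rmult_lt_0_compat; [easy | now apply Rdiv_lt_0_compat].
    - replace (INR j * (PI / INR (S M))) with (PI * INR j / INR (S M)) by (field; lra).
      apply Rlt_div_l; nra. }
  pose proof (sum_sin_arith (2 * INR j * t + c) b M) as H.
  replace (2 * INR j * t + c - (2 * INR M + 1) * b)
    with (2 * INR j * t + c + b - 2 * INR j * PI) in H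
    by (unfold b; rewrite S_INR in *; field; lra).
  rewrite <- (cos_period (_ - _) j) in H.
  replace (2 * INR j * t + c + b - 2 * INR j * PI + 2 * INR j * PI)
    with (2 * INR j * t + c + b) in H by ring.
  rewrite Rminus_diag in H.
  rewrite (sum_n_ext _ (fun k => sin (2 * INR j * t + c - 2 * INR k * b))).
  - apply Rmult_integral in H as [H|H]; [lra | exact H].
  - intros k. f_equal. unfold b, node. field. lra.
Qed.

Lemma sum_sin_node (M j : nat) (t : R) :
  (j <= M)%nat -> sum_n (fun k => sin (2 * INR j * node M t k)) M = 0 :> R.
Proof.
  intros Hj. destruct j as [|j].
  - rewrite (sum_n_ext _ (fun _ => 0)), sum_n_const; [apply Rmult_0_r|].
    intros k. simpl INR. rewrite Rmult_0_r, Rmult_0_l. apply sin_0.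
  - rewrite <- (sum_sin_node_add M (S j) t 0) by lia.
    apply sum_n_ext. intros k. now rewrite Rplus_0_r.
Qed.

Lemma sum_cos_node (M j : nat) (t : R) :
  (1 <= j <= M)%nat -> sum_n (fun k => cos (2 * INR j * node M t k)) M = 0 :> R.
Proof.
  intros Hj. rewrite <- (sum_sin_node_add M j t (PI / 2)) by easy.
  apply sum_n_ext. intros k. now rewrite Rplus_comm, <- cos_sin.
Qed.

Lemma sin_sq_step (a t : R) : sin (a * t + t) ^ 2 = sin (a * t) ^ 2 + sin (2 * a * t + t) * sin t.
Proof.
  replace (2 * a * t + t) with ((a * t + t) + a * t) by ring.
  replace (sin t) with (sin ((a * t + t) - a * t)) by (f_equal; ring).
  set (u := a * t + t). set (v := a * t).
  rewrite sin_plus, sin_minus.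
  pose proof (sin2_cos2 u) as E1. pose proof (sin2_cos2 v) as E2. unfold Rsqr in *.
  replace (sin u ^ 2) with (sin u ^ 2 * (sin v * sin v + cos v * cos v)) by (rewrite E2; ring).
  replace (sin v ^ 2) with (sin v ^ 2 * (sin u * sin u + cos u * cos u)) by (rewrite E1; ring).
  ring.
Qed.

Lemma sin_add_IZR_PI_sq (u : R) (z : Z) : sin (u + IZR z * PI) ^ 2 = sin u ^ 2.
Proof.
  assert (H : sin (IZR z * PI) = 0) by (apply sin_eq_0_1; now exists z).
  pose proof (sin2_cos2 (IZR z * PI)) as E. unfold Rsqr in E. rewrite H in E.
  rewrite sin_plus, H.
  transitivity (sin u ^ 2 * (0 * 0 + cos (IZR z * PI) * cos (IZR z * PI))); [ring|].
  rewrite E. ring.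
Qed.

Lemma sin_add_2_IZR_PI (u : R) (z : Z) : sin (u + 2 * (IZR z * PI)) = sin u.
Proof.
  assert (H : sin (IZR z * PI) = 0) by (apply sin_eq_0_1; now exists z).
  rewrite sin_plus, sin_2a, cos_2a_sin, H. ring.
Qed.

Section NodeSums.
Variables (M : nat) (t : R).
Hypothesis Hs : forall k, (k <= M)%nat -> sin (node M t k) <> 0.

Let N := INR (S M).

(** The summand is a Dirichlet kernel. Passing from [n] to [S n] adds [2 cos (2 (n + 1) u)], whose
    sum over the nodes vanishes as long as [S n <= M]. *)
Lemma sum_dirichlet_node (n : nat) : (n <= M)%nat ->
  sum_n (fun k => sin (2 * INR n * node M t k + node M t k) / sin (node M t k)) M = N :> R.
Proof.
  induction n as [|n IH]; intros Hn.
  - rewrite (sum_n_ext_loc _ (fun _ => 1)), sum_n_const; [apply Rmult_1_r|].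
    intros k Hk. simpl INR. rewrite Rmult_0_r, Rmult_0_l, Rplus_0_l. now apply Rdiv_diag, Hs.
  - rewrite (sum_n_linear (fun k => sin (2 * INR n * node M t k + node M t k) / sin (node M t k))
               (fun k => cos (2 * INR (S n) * node M t k)) _ 1 2).
    + rewrite IH, sum_cos_node by lia. ring.
    + intros k Hk. rewrite S_INR. set (u := node M t k).
      replace (2 * INR n * u + u) with (2 * (INR n + 1) * u - u) by ring.
      rewrite sin_plus, sin_minus. field. now apply Hs.
Qed.

(** By [sin_sq_step] the summand is a sum of [n] Dirichlet kernels, each contributing [N]. The case
    [n = S M] yields the cosecant sum, since [sin (N u) ^ 2] is the same at all nodes. *)
Lemma sum_fejer_node (n : nat) : (n <= S M)%nat ->
  sum_n (fun k => sin (INR n * node M t k) ^ 2 / sin (node M t k) ^ 2) M = INR n * N :> R.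
Proof.
  induction n as [|n IH]; intros Hn.
  - rewrite (sum_n_ext _ (fun _ => 0)), sum_n_const; [now rewrite Rmult_0_r, Rmult_0_l|].
    intros k. simpl INR. rewrite Rmult_0_l, sin_0, pow_i by lia. apply Rdiv_0_l.
  - rewrite (sum_n_linear (fun k => sin (INR n * node M t k) ^ 2 / sin (node M t k) ^ 2)
      (fun k => sin (2 * INR n * node M t k + node M t k) / sin (node M t k)) _ 1 1).
    + rewrite IH, sum_dirichlet_node, S_INR by lia. ring.
    + intros k Hk. rewrite S_INR, Rmult_plus_distr_r, Rmult_1_l, sin_sq_step. field. now apply Hs.
Qed.

(** The increment in [n] is [sin ((2n + 1) u) cos u], half the sum of the sines of [2 (n + 1) u] and
    [2 n u]. The right side vanishes for [n <= M]; it is kept for the case [n = S M], which gives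
    the cotangent sum. *)
Lemma sum_conj_fejer_node (n : nat) : (n <= S M)%nat ->
  sum_n (fun k => sin (INR n * node M t k) ^ 2 * (cos (node M t k) / sin (node M t k))) M
  = / 2 * sum_n (fun k => sin (2 * INR n * node M t k)) M :> R.
Proof.
  induction n as [|n IH]; intros Hn.
  - rewrite sum_sin_node by lia.
    rewrite (sum_n_ext _ (fun _ => 0)), sum_n_const, Rmult_0_r; [symmetry; apply Rmult_0_r|].
    intros k. simpl INR. rewrite Rmult_0_l, sin_0, pow_i by lia. apply Rmult_0_l.
  - rewrite (sum_n_linear
      (fun k => sin (INR n * node M t k) ^ 2 * (cos (node M t k) / sin (node M t k)))
      (fun k => / 2 * sin (2 * INR (S n) * node M t k) + / 2 * sin (2 * INR n * node M t k)) _ 1 1).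
    + rewrite IH by lia.
      rewrite (sum_n_linear (fun k => sin (2 * INR (S n) * node M t k))
                 (fun k => sin (2 * INR n * node M t k))
                 (fun k => / 2 * sin (2 * INR (S n) * node M t k)
                           + / 2 * sin (2 * INR n * node M t k)) (/ 2) (/ 2)) by reflexivity.
      rewrite (sum_sin_node M n) by lia. ring.
    + intros k Hk. rewrite S_INR, Rmult_plus_distr_r, Rmult_1_l, sin_sq_step.
      set (u := node M t k).
      set (w := 2 * INR n * u + u).
      replace (2 * (INR n + 1) * u) with (w + u) by (unfold w; ring).
      replace (2 * INR n * u) with (w - u) by (unfold w; ring).
      rewrite sin_plus, sin_minus. field. now apply Hs.
Qed.

Lemma mul_node (k : nat) : N * node M t k = N * t - INR k * PI.
Proof. unfold node, N. pose proof (INR_S_pos M). field. lra. Qed.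

Lemma sin_mul_node_sq (k : nat) : sin (N * node M t k) ^ 2 = sin (N * t) ^ 2.
Proof.
  rewrite mul_node, INR_IZR_INZ, <- (sin_add_IZR_PI_sq (N * t) (- Z.of_nat k)), opp_IZR.
  do 2 f_equal. ring.
Qed.

Lemma sum_csc2_node :
  sin (N * t) ^ 2 * sum_n (fun k => 1 / sin (node M t k) ^ 2) M = N ^ 2.
Proof.
  replace (N ^ 2) with (INR (S M) * N) by (unfold N; ring).
  rewrite <- (sum_fejer_node (S M)) by lia. symmetry.
  rewrite (sum_n_linear (fun k => 1 / sin (node M t k) ^ 2) (fun _ => 0) _ (sin (N * t) ^ 2) 0).
  - ring.
  - intros k Hk. fold N. rewrite sin_mul_node_sq. field. now apply Hs.
Qed.

Lemma sum_cot_node :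
  sin (N * t) ^ 2 * sum_n (fun k => cos (node M t k) / sin (node M t k)) M
  = N * (sin (N * t) * cos (N * t)).
Proof.
  transitivity (sum_n (fun k => sin (INR (S M) * node M t k) ^ 2
                                * (cos (node M t k) / sin (node M t k))) M).
  - symmetry. rewrite (sum_n_linear (fun k => cos (node M t k) / sin (node M t k)) (fun _ => 0) _
               (sin (N * t) ^ 2) 0).
    + ring.
    + intros k Hk. fold N. rewrite sin_mul_node_sq. field. now apply Hs.
  - rewrite sum_conj_fejer_node by lia. fold N.
    rewrite (sum_n_ext _ (fun _ => 2 * (sin (N * t) * cos (N * t)))), sum_n_const.
    + fold N. field.
    + intros k. rewrite Rmult_assoc, mul_node.
      replace (2 * (N * t - INR k * PI)) with (2 * (N * t) - 2 * INR k * PI) by ring.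
      rewrite <- (sin_period (_ - _) k).
      replace (2 * (N * t) - 2 * INR k * PI + 2 * INR k * PI) with (2 * (N * t)) by ring.
      rewrite sin_2a. apply Rmult_assoc.
Qed.

End NodeSums.

(** * Telescoping sums and sums with one nonzero term *)

Lemma sum_n_telescope (u : nat -> R) (n : nat) :
  sum_n (fun k => u k - u (S k)) n = u 0%nat - u (S n) :> R.
Proof.
  induction n as [|n IH].
  - now rewrite sum_O.
  - rewrite sum_Sn, IH. change plus with Rplus. ring.
Qed.

Lemma Rabs_sum_n_le_telescope (e u : nat -> R) (c : R) (n : nat) :
  (forall k, (k <= n)%nat -> Rabs (e k) <= c * (u k - u (S k))) ->
  Rabs (sum_n e n) <= c * (u 0%nat - u (S n)).
Proof.
  intros H. induction n as [|n IH].
  - rewrite sum_O. now apply H.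
  - rewrite sum_Sn. change plus with Rplus.
    eapply Rle_trans; [apply Rabs_triang|].
    pose proof (IH (fun k Hk => H k (le_S _ _ Hk))). pose proof (H (S n) (le_n _)). lra.
Qed.

Lemma sum_n_single (a : nat -> R) (j n : nat) :
  (j <= n)%nat -> (forall k, (k <= n)%nat -> k <> j -> a k = 0) -> sum_n a n = a j :> R.
Proof.
  intros Hj H. rewrite (sum_n_ext_loc a (fun k => if Nat.eq_dec k j then a j else 0)).
  - clear H. induction n as [|n IH].
    + rewrite sum_O. destruct (Nat.eq_dec 0 j); [easy | lia].
    + rewrite sum_Sn. change plus with Rplus. destruct (Nat.eq_dec (S n) j) as [<-|E].
      * rewrite (sum_n_ext_loc _ (fun _ => 0)), sum_n_const.
        -- rewrite Rmult_0_r. apply Rplus_0_l.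
        -- intros k Hk. destruct (Nat.eq_dec k (S n)); [lia | easy].
      * rewrite IH by lia. apply Rplus_0_r.
  - intros k Hk. destruct (Nat.eq_dec k j) as [->|E]; [easy | now apply H].
Qed.

(** * The Vaaler polynomial: periodicity and grid points *)

Lemma frac_part_eq0_iff (y : R) : frac_part y = 0 <-> sin (PI * y) = 0.
Proof.
  pose proof PI_RGT_0. split; intros Hy.
  - apply fp_nat in Hy as [z ->]. apply sin_eq_0_1. exists z. ring.
  - apply sin_eq_0_0 in Hy as [z Hz]. symmetry.
    apply (Int_part_frac_part_spec y z 0); [lra|].
    apply (Rmult_eq_reg_l PI); lra.
Qed.

Lemma frac_part_add_IZR (y : R) (z : Z) : frac_part (y + IZR z) = frac_part y.
Proof.
  symmetry. apply (Int_part_frac_part_spec _ (Int_part y + z)).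
  - pose proof (base_fp y). lra.
  - rewrite plus_IZR, (Rplus_Int_part_frac_part y) at 1. ring.
Qed.

Lemma fejer_add_IZR (n : nat) (y : R) (z : Z) : fejer n (y + IZR z) = fejer n y.
Proof.
  unfold fejer. rewrite frac_part_add_IZR. destruct (Req_dec_T _ _); [easy|].
  unfold Rdiv. rewrite !Rpow_mult_distr, !pow_inv.
  replace (PI * INR n * (y + IZR z)) with (PI * INR n * y + IZR (Z.of_nat n * z) * PI)
    by (rewrite mult_IZR, INR_IZR_INZ; ring).
  replace (PI * (y + IZR z)) with (PI * y + IZR z * PI) by ring.
  now rewrite !sin_add_IZR_PI_sq.
Qed.

Lemma vaaler_add_IZR (M : nat) (y : R) (z : Z) : vaaler M (y + IZR z) = vaaler M y.
Proof.
  unfold vaaler. rewrite fejer_add_IZR.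
  replace (2 * PI * INR (M + 1) * (y + IZR z))
    with (2 * PI * INR (M + 1) * y + 2 * (IZR (Z.of_nat (M + 1) * z) * PI))
    by (rewrite mult_IZR, <- INR_IZR_INZ; ring).
  replace (2 * PI * (y + IZR z)) with (2 * PI * y + 2 * (IZR z * PI)) by ring.
  rewrite !sin_add_2_IZR_PI. do 3 f_equal.
  apply sum_n_m_ext. intros k.
  replace (y + IZR z - INR k / INR (M + 1)) with (y - INR k / INR (M + 1) + IZR z) by ring.
  now rewrite fejer_add_IZR.
Qed.

Lemma fejer_eq0 (n : nat) (y : R) : sin (PI * INR n * y) = 0 -> sin (PI * y) <> 0 -> fejer n y = 0.
Proof.
  intros H H'. unfold fejer. destruct (Req_dec_T _ _) as [E|_].
  - now apply frac_part_eq0_iff in E.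
  - rewrite H. unfold Rdiv. ring.
Qed.

Lemma sum_n_1 (a : nat -> R) (n : nat) : sum_n_m a 1 n = sum_n a n - a 0%nat :> R.
Proof.
  unfold sum_n. rewrite (sum_Sn_m a 0 n) by lia. symmetry. apply Rplus_minus_l.
Qed.

(** At a grid point all Fejér terms vanish except the one with [k = j], which equals [N] and carries
    the weight [x - 1 / 2]. For [j = 0] that term is outside the sum, which leaves the value 0. *)
Lemma vaaler_eq_sawtooth_grid (M j : nat) :
  (j <= M)%nat -> vaaler M (INR j / INR (S M)) = sawtooth (INR j / INR (S M)).
Proof.
  intros Hj. pose proof (INR_S_pos M) as HN. pose proof PI_RGT_0 as HPI.
  set (N := INR (S M)) in *. set (x := INR j / N).
  assert (Hx : 0 <= x < 1).
  { unfold x. split; [apply Rdiv_le_0_compat; [apply pos_INR | easy]|].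
    apply Rlt_div_l; [easy|]. rewrite Rmult_1_l. apply lt_INR. lia. }
  assert (Hz : forall k, sin (PI * N * (x - INR k / N)) = 0).
  { intros k. apply sin_eq_0_1. exists (Z.of_nat j - Z.of_nat k)%Z.
    rewrite minus_IZR, <- !INR_IZR_INZ. unfold x. field. lra. }
  assert (Hnz : forall k, (k <= M)%nat -> k <> j -> sin (PI * (x - INR k / N)) <> 0).
  { intros k Hk Hkj E. apply sin_eq_0_0 in E as [z E].
    assert (Ez : INR j - INR k = IZR z * N).
    { apply (Rmult_eq_reg_l (PI / N)); [| apply Rgt_not_eq; now apply Rdiv_lt_0_compat].
      transitivity (PI * (x - INR k / N)); [unfold x; field; lra | rewrite E; field; lra]. }
    unfold N in Ez. rewrite !INR_IZR_INZ, <- minus_IZR, <- mult_IZR in Ez.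
    apply eq_IZR in Ez.
    assert (z = 0)%Z by nia. subst z. lia. }
  assert (Hf0 : fejer (S M) (x - INR j / N) = N).
  { unfold fejer. destruct (Req_dec_T _ _) as [_|E]; [easy|].
    exfalso. apply E. unfold x. rewrite Rminus_diag. apply fp_R0. }
  assert (Hs : frac_part x = x) by (symmetry; apply (Int_part_frac_part_spec x 0); lra).
  assert (S2 : sin (2 * PI * N * x) = 0).
  { replace (2 * PI * N * x) with (0 + 2 * (IZR (Z.of_nat j) * PI))
      by (rewrite <- INR_IZR_INZ; unfold x; field; lra).
    now rewrite sin_add_2_IZR_PI, sin_0. }
  unfold vaaler, sawtooth. rewrite Nat.add_1_r, sum_n_1. fold N. rewrite Hs, S2.
  rewrite (sum_n_single _ j M Hj)
    by (intros k Hk Hkj; rewrite fejer_eq0; [apply Rmult_0_r | apply Hz | now apply Hnz]).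
  cbv beta. rewrite Hf0. destruct j as [|j].
  - assert (x0 : x = 0) by (unfold x; simpl; field; lra).
    assert (Hsin : sin (2 * PI * x) = 0) by (rewrite x0, Rmult_0_r; apply sin_0).
    rewrite Hsin, Hf0. destruct (Req_dec_T x 0); [simpl; field; lra | easy].
  - assert (E : fejer (S M) (x - INR 0 / N) = 0)
      by (apply fejer_eq0; [apply Hz | apply Hnz; lia]).
    rewrite E. simpl (INR 0) in E. rewrite Rdiv_0_l, Rminus_0_r in E. rewrite E.
    assert (0 < x) by (unfold x; apply Rdiv_lt_0_compat; [apply INR_S_pos | easy]).
    destruct (Req_dec_T x 0); [lra|]. fold x. field. lra.
Qed.

(** * The error as a trapezoidal error *)

Lemma ker_sub_PI (t : R) : sin t <> 0 -> ker (t - PI) = ker t - PI / sin t ^ 2.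
Proof.
  intros H. unfold ker. rewrite sin_minus, cos_minus, sin_PI, cos_PI. field. lra.
Qed.

Lemma ker_prim_sub_PI (t : R) :
  sin t <> 0 -> ker_prim (t - PI) = ker_prim t + PI * (cos t / sin t).
Proof.
  intros H. unfold ker_prim. rewrite sin_minus, cos_minus, sin_PI, cos_PI. field. lra.
Qed.

Lemma node_0 (M : nat) (t : R) : node M t 0 = t.
Proof. unfold node. simpl INR. ring. Qed.

Lemma node_S (M : nat) (t : R) : node M t (S M) = t - PI.
Proof. unfold node. pose proof (INR_S_pos M). field. lra. Qed.

Lemma node_sub (M k : nat) (t : R) : node M t k - node M t (S k) = PI / INR (S M).
Proof. unfold node. rewrite (S_INR k). ring. Qed.

(** The nodes decrease from [t] to [t - PI], so panel [k] has [node M t (S k)] as its left end. *)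
Definition trapezoid_err (M : nat) (t : R) : R :=
  sum_n (fun k => panel_err (node M t (S k)) (node M t k)) M.

Lemma trapezoid_err_eq (M : nat) (t : R) :
  sin t <> 0 ->
  trapezoid_err M t
  = PI / INR (S M) * (sum_n (fun k => ker (node M t k)) M - PI / (2 * sin t ^ 2))
    + PI * (cos t / sin t).
Proof.
  intros H. unfold trapezoid_err. set (d := PI / INR (S M)).
  (* Each panel error is [d * ker (node M t k)] minus an increment of [u], so only the values of [u]
     at [t] and [t - PI] remain. *)
  set (u := fun k => d / 2 * ker (node M t k) + ker_prim (node M t k)).
  rewrite (sum_n_linear (fun k => ker (node M t k)) (fun k => u k - u (S k)) _ d (-1)).
  - rewrite sum_n_telescope. unfold u. rewrite node_0, node_S, ker_sub_PI, ker_prim_sub_PI by easy.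
    field. easy.
  - intros k _. unfold panel_err, u. rewrite node_sub. fold d. field.
Qed.

Lemma fejer_sub_node (M k : nat) (x : R) :
  sin (node M (PI * x) k) <> 0 ->
  fejer (S M) (x - INR k / INR (S M))
  = 1 / INR (S M) * (sin (INR (S M) * (PI * x)) ^ 2 / sin (node M (PI * x) k) ^ 2).
Proof.
  intros H. pose proof (INR_S_pos M).
  assert (E : PI * (x - INR k / INR (S M)) = node M (PI * x) k) by (unfold node; field; lra).
  unfold fejer. destruct (Req_dec_T _ _) as [F|_].
  - apply frac_part_eq0_iff in F. now rewrite E in F.
  - rewrite (Rmult_comm PI), Rmult_assoc, E, <- (sin_mul_node_sq M (PI * x) k). field. lra.
Qed.

(** The weight [k / N - 1 / 2] is [x - 1 / 2 - node / PI], and [u / sin^2 u] is [ker u + cot u]. The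
    cosecant sum then produces [x - 1 / 2], and the cotangent sum cancels the term with
    [sin (2 PI N x)]. The missing term [k = 0] and the last term of [vaaler] supply the two boundary
    terms of [trapezoid_err_eq]. *)
Lemma vaaler_sub_eq (M : nat) (x : R) :
  (forall k, (k <= M)%nat -> sin (node M (PI * x) k) <> 0) ->
  vaaler M x - (x - 1 / 2)
  = - (sin (INR (S M) * (PI * x)) ^ 2 / (PI ^ 2 * INR (S M)) * trapezoid_err M (PI * x)).
Proof.
  intros Hs. pose proof PI_RGT_0 as HPI. pose proof (INR_S_pos M) as HN.
  assert (H0 : sin (PI * x) <> 0) by (rewrite <- (node_0 M (PI * x)); apply Hs; lia).
  rewrite trapezoid_err_eq by easy.
  pose proof (sum_csc2_node M (PI * x) Hs) as HA.
  pose proof (sum_cot_node M (PI * x) Hs) as HB.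
  unfold vaaler. rewrite Nat.add_1_r, sum_n_1.
  set (N := INR (S M)) in *. set (t := PI * x) in *. set (Sn := sin (N * t)) in *.
  rewrite (sum_n_linear (fun k => 1 / sin (node M t k) ^ 2)
    (fun k => 1 * ker (node M t k) + 1 * (cos (node M t k) / sin (node M t k))) _
    ((x - 1 / 2) * (Sn ^ 2 / N)) (- (Sn ^ 2 / (PI * N)))).
  2: { intros k Hk. rewrite fejer_sub_node by (now apply Hs). fold N t Sn.
       pose proof (Hs k Hk). unfold ker.
       replace (INR k / N) with (x - node M t k / PI) by (unfold node, t; fold N; field; lra).
       field. repeat split; lra. }
  rewrite (sum_n_linear (fun k => ker (node M t k))
    (fun k => cos (node M t k) / sin (node M t k))
    (fun k => 1 * ker (node M t k) + 1 * (cos (node M t k) / sin (node M t k))) 1 1) by reflexivity.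
  set (A := sum_n (fun k => 1 / sin (node M t k) ^ 2) M) in *.
  set (B := sum_n (fun k => cos (node M t k) / sin (node M t k)) M) in *.
  set (K := sum_n (fun k => ker (node M t k)) M).
  rewrite fejer_sub_node by (apply Hs; lia). fold t N. rewrite node_0.
  assert (F0 : fejer (S M) x = 1 / N * (Sn ^ 2 / sin t ^ 2)).
  { replace x with (x - INR 0 / INR (S M)) at 1 by (simpl; field; unfold N in HN; simpl in HN; lra).
    rewrite fejer_sub_node by (apply Hs; lia). now rewrite node_0. }
  rewrite F0. fold Sn.
  replace (2 * PI * N * x) with (2 * (N * t)) by (unfold t; ring).
  replace (2 * PI * x) with (2 * t) by (unfold t; ring).
  rewrite !sin_2a. fold Sn. set (C := cos (N * t)) in *.
  transitivity ((x - 1 / 2) * ((Sn ^ 2 * A) / N ^ 2) - (Sn ^ 2 * B) / (PI * N ^ 2)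
    - Sn ^ 2 * K / (PI * N ^ 2) + Sn ^ 2 / (2 * N ^ 2 * sin t ^ 2) + Sn * C / (PI * N)
    - Sn ^ 2 * cos t / (PI * N * sin t) - (x - 1 / 2)).
  - simpl (INR 0). field. lra.
  - rewrite HA, HB. field. lra.
Qed.

(** * Bounds for the trapezoidal error and for the Vaaler error *)

Section TrapezoidBounds.
Variables (M : nat) (x : R).
Hypothesis HM : (1 <= M)%nat.
Hypothesis Hx : 0 < x < 1.
Hypothesis Hs : forall k, (k <= M)%nat -> sin (node M (PI * x) k) <> 0.

Let t := PI * x.
Let N := INR (S M).

Lemma panel_err_node_bounds (k : nat) : (k <= M)%nat ->
  Rabs (panel_err (node M t (S k)) (node M t k))
  <= PI / N / 2 * (ker (node M t k) - ker (node M t (S k))) /\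
  Rabs (panel_err (node M t (S k)) (node M t k))
  <= (PI / N) ^ 2 / 8 * (signed_deriv (node M t k) - signed_deriv (node M t (S k))).
Proof.
  intros Hk. pose proof PI_RGT_0 as HPI.
  (* [HM] gives at least two panels, hence a step of at most [PI / 2], as [panel_err_bounds]
     requires. *)
  assert (HN : 2 <= N) by (apply (le_INR 2); lia).
  assert (Ht : 0 < t < PI) by (unfold t; nra).
  assert (Hd : 0 < PI / N) by (apply Rdiv_lt_0_compat; lra).
  assert (Hd2 : PI / N <= PI / 2) by (apply Rmult_le_compat_l; [lra | apply Rinv_le_contravar; lra]).
  pose proof (node_sub M k t) as Hsub. fold N in Hsub.
  assert (Hk1 : node M t k <= t).
  { unfold node. fold N. pose proof (pos_INR k). nra. }
  assert (Hk2 : t - PI <= node M t (S k)).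
  { rewrite <- (node_S M). unfold node. fold N.
    assert (INR (S k) <= N) by (apply le_INR; lia).
    apply Rplus_le_compat_l, Ropp_le_contravar, Rmult_le_compat_r; lra. }
  assert (Hnz : node M t k <> 0).
  { intros E. apply (Hs k Hk). fold t. rewrite E. apply sin_0. }
  (* [Hs] stops at index [M]; the node of index [S M] is [t - PI], which is negative. *)
  assert (Hnz' : node M t (S k) <> 0).
  { destruct (Nat.eq_dec k M) as [->|E]; [rewrite node_S; lra|].
    intros E'. apply (Hs (S k)); [lia|]. fold t. rewrite E'. apply sin_0. }
  destruct (panel_err_bounds (node M t (S k)) (node M t k)) as [H1 H2]; try lra.
  rewrite Hsub in H1, H2. split; [lra | exact H2].
Qed.

Lemma trapezoid_err_le_csc2 :
  Rabs (trapezoid_err M t) <= PI ^ 2 / (2 * N * sin t ^ 2).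
Proof.
  assert (H0 : sin t <> 0) by (rewrite <- (node_0 M t); apply Hs; lia).
  pose proof (INR_S_pos M) as HN.
  eapply Rle_trans; [apply (Rabs_sum_n_le_telescope _ (fun k => ker (node M t k)) (PI / N / 2))|].
  - intros k Hk. now apply panel_err_node_bounds.
  - rewrite node_0, node_S, ker_sub_PI by easy. right. fold N in HN. field. lra.
Qed.

(** The telescoped sum runs from [t > 0] to [t - PI < 0], so the two values of [ker_deriv] add up,
    and the constants 2 in [signed_deriv] make the 4. *)
Lemma trapezoid_err_le_deriv :
  Rabs (trapezoid_err M t)
  <= PI ^ 2 / (8 * N ^ 2) * (ker_deriv t + ker_deriv (PI - t) + 4).
Proof.
  assert (H0 : sin t <> 0) by (rewrite <- (node_0 M t); apply Hs; lia).
  pose proof (INR_S_pos M) as HN. pose proof PI_RGT_0.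
  assert (Ht : 0 < t < PI) by (unfold t; nra).
  eapply Rle_trans;
    [apply (Rabs_sum_n_le_telescope _ (fun k => signed_deriv (node M t k)) ((PI / N) ^ 2 / 8))|].
  - intros k Hk. now apply panel_err_node_bounds.
  - rewrite node_0, node_S. unfold signed_deriv.
    destruct (Rlt_dec 0 t); [|lra]. destruct (Rlt_dec 0 (t - PI)); [lra|].
    rewrite <- (ker_deriv_opp (t - PI)) by (rewrite sin_minus, sin_PI, cos_PI; lra).
    rewrite Ropp_minus_distr. right. fold N in HN. field. lra.
Qed.

Lemma vaaler_sub_le_half : Rabs (vaaler M x - (x - 1 / 2)) <= 1 / 2.
Proof.
  rewrite vaaler_sub_eq, Rabs_Ropp, Rabs_mult by easy. fold t N.
  pose proof (INR_S_pos M) as HN. fold N in HN. pose proof PI_RGT_0 as HPI.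
  assert (H0 : sin t <> 0) by (rewrite <- (node_0 M t); apply Hs; lia).
  (* This absorbs the [sin t ^ 2] in the denominator of [trapezoid_err_le_csc2]. *)
  assert (HS : sin (N * t) ^ 2 <= N ^ 2 * sin t ^ 2).
  { rewrite <- (pow2_abs (sin (N * t))), <- (pow2_abs (sin t)), <- Rpow_mult_distr.
    apply pow_incr. split; [apply Rabs_pos | apply Rabs_sin_mul_le]. }
  assert (Hp : 0 < PI ^ 2 * N) by (apply Rmult_lt_0_compat; [now apply pow_lt | easy]).
  assert (Hs2 : 0 < sin t ^ 2) by (rewrite <- Rsqr_pow2; now apply Rsqr_pos_lt).
  rewrite Rabs_pos_eq by (apply Rdiv_le_0_compat; [apply pow2_ge_0 | easy]).
  eapply Rle_trans; [apply Rmult_le_compat_l; [| apply trapezoid_err_le_csc2]|].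
  - apply Rdiv_le_0_compat; [apply pow2_ge_0 | easy].
  - replace (sin (N * t) ^ 2 / (PI ^ 2 * N) * (PI ^ 2 / (2 * N * sin t ^ 2)))
      with (sin (N * t) ^ 2 / (2 * (N ^ 2 * sin t ^ 2))) by (field; lra).
    assert (0 < N ^ 2 * sin t ^ 2) by (apply Rmult_lt_0_compat; [now apply pow_lt | easy]).
    apply Rle_div_l; lra.
Qed.

Lemma vaaler_sub_le_deriv :
  Rabs (vaaler M x - (x - 1 / 2)) <= (ker_deriv t + ker_deriv (PI - t) + 4) / (8 * N ^ 3).
Proof.
  rewrite vaaler_sub_eq, Rabs_Ropp, Rabs_mult by easy. fold t N.
  pose proof (INR_S_pos M) as HN. fold N in HN. pose proof PI_RGT_0 as HPI.
  assert (Hp : 0 < PI ^ 2 * N) by (apply Rmult_lt_0_compat; [now apply pow_lt | easy]).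
  rewrite Rabs_pos_eq by (apply Rdiv_le_0_compat; [apply pow2_ge_0 | easy]).
  replace ((ker_deriv t + ker_deriv (PI - t) + 4) / (8 * N ^ 3))
    with (1 / (PI ^ 2 * N)
          * (PI ^ 2 / (8 * N ^ 2) * (ker_deriv t + ker_deriv (PI - t) + 4))) by (field; lra).
  apply Rmult_le_compat; [| apply Rabs_pos | | apply trapezoid_err_le_deriv].
  - apply Rdiv_le_0_compat; [apply pow2_ge_0 | easy].
  - apply Rmult_le_compat_r; [left; now apply Rinv_0_lt_compat|].
    pose proof (SIN_bound (N * t)). nra.
Qed.

End TrapezoidBounds.

(** * Estimates by the distance to the nearest integer *)

(** The two derivatives add up to [(4 + 2 (PI - 2t) cot t) / sin^2 t]. With [sin t >= 2x] and
    [cot t <= 1 / t] the left side is at most [1 / (2 x^3) + 4], and [8 x^3 <= 1] finishes. Equality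
    holds at [x = 1 / 2]. *)
Lemma ker_deriv_sum_le_left_half (x : R) :
  0 < x <= 1 / 2 -> ker_deriv (PI * x) + ker_deriv (PI - PI * x) + 4 <= 1 / x ^ 3.
Proof.
  intros Hx. pose proof PI_RGT_0 as HPI. set (t := PI * x).
  assert (Ht : 0 < t <= PI / 2) by (unfold t; nra).
  assert (Hs : 2 * x <= sin t).
  { replace (2 * x) with (2 * t / PI) by (unfold t; field; lra). now apply jordan. }
  assert (Hc : cos t / sin t <= 1 / t).
  { apply Rle_div_l; [lra|]. pose proof (mul_cos_le_sin t).
    apply (Rmult_le_reg_l t); [lra|]. replace (t * (1 / t * sin t)) with (sin t) by (field; lra). lra. }
  assert (Hc0 : 0 <= cos t / sin t) by (apply Rdiv_le_0_compat; [apply cos_ge_0; lra | lra]).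
  assert (Hs2 : / sin t ^ 2 <= / (4 * x ^ 2)) by (apply Rinv_le_contravar; nra).
  assert (Hs3 : 0 < / sin t ^ 2) by (apply Rinv_0_lt_compat, pow_lt; lra).
  replace (ker_deriv t + ker_deriv (PI - t))
    with (/ sin t ^ 2 * (4 + 2 * ((PI - 2 * t) * (cos t / sin t))))
    by (unfold ker_deriv; rewrite sin_PI_x, cos_minus, cos_PI, sin_PI; field; lra).
  assert (H1 : (PI - 2 * t) * (cos t / sin t) <= (1 - 2 * x) / x).
  { replace ((1 - 2 * x) / x) with ((PI - 2 * t) * (1 / t)) by (unfold t; field; lra).
    apply Rmult_le_compat_l; lra. }
  assert (H2 : 0 <= (PI - 2 * t) * (cos t / sin t)) by (apply Rmult_le_pos; lra).
  apply (Rle_trans _ (/ (4 * x ^ 2) * (4 + 2 * ((1 - 2 * x) / x)) + 4)).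
  - apply Rplus_le_compat_r, Rmult_le_compat; lra.
  - replace (/ (4 * x ^ 2) * (4 + 2 * ((1 - 2 * x) / x)) + 4)
      with ((1 + 8 * x ^ 3) / (2 * x ^ 3)) by (field; lra).
    assert (0 < x ^ 3) by (apply pow_lt; lra).
    assert (x ^ 3 <= (1 / 2) ^ 3) by (apply pow_incr; lra).
    apply Rle_div_l; [lra|]. replace (1 / x ^ 3 * (2 * x ^ 3)) with 2 by (field; lra). lra.
Qed.

Lemma ker_deriv_sum_le (x : R) :
  0 < x < 1 ->
  ker_deriv (PI * x) + ker_deriv (PI - PI * x) + 4 <= 1 / Rmin x (1 - x) ^ 3.
Proof.
  intros Hx. destruct (Rle_dec x (1 / 2)) as [H|H].
  - rewrite Rmin_left by lra. apply ker_deriv_sum_le_left_half. lra.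
  - rewrite Rmin_right by lra. pose proof (ker_deriv_sum_le_left_half (1 - x)) as E.
    replace (PI * (1 - x)) with (PI - PI * x) in E by ring.
    replace (PI - (PI - PI * x)) with (PI * x) in E by ring. lra.
Qed.

Lemma dist_nearest_int_eq (x : R) :
  dist_nearest_int x = Rmin (frac_part x) (1 - frac_part x).
Proof.
  unfold dist_nearest_int. pose proof (base_fp x) as Hf.
  pose proof (Rplus_Int_part_frac_part x) as Ex.
  set (f := frac_part x) in *. set (z := Int_part x) in *.
  rewrite (is_glb_Rbar_unique _ (Finite (Rmin f (1 - f)))); [easy|]. split.
  - intros d [n ->]. simpl.
    destruct (Z_le_gt_dec n z) as [H|H].
    + apply IZR_le in H. rewrite Rabs_pos_eq by lra.
      pose proof (Rmin_l f (1 - f)). lra.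
    + assert (H' : (z + 1 <= n)%Z) by lia. apply IZR_le in H'. rewrite plus_IZR in H'.
      rewrite Rabs_left1 by lra. pose proof (Rmin_r f (1 - f)). lra.
  - intros b Hb. apply Rmin_case.
    + apply Hb. exists z. rewrite Rabs_pos_eq; lra.
    + apply Hb. exists (z + 1)%Z. rewrite plus_IZR, Rabs_left1; lra.
Qed.

Lemma tail_constant_ge : 1 / 8 <= (PI ^ 4 + 10 * PI ^ 2 + 15) / (480 * PI).
Proof.
  pose proof PI2_3_2. apply (Rle_div_r (1 / 8)); [lra|].
  (* The claim is [60 PI <= PI^4 + 10 PI^2 + 15]; the product expands to
     [PI^4 + 10 PI^2 - 60 PI + 9]. *)
  assert (0 <= (PI - 3) * (PI ^ 3 + 3 * PI ^ 2 + 19 * PI - 3)) by (apply Rmult_le_pos; nra).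
  lra.
Qed.

(** * Reduction to one period and conclusion *)

(** A zero of the sine at node [k] makes [x - k / N] an integer, and this integer is 0 because both
    terms lie in [[0, 1)]. *)
Lemma node_zero_dec (M : nat) (x : R) :
  0 <= x < 1 ->
  (exists j, (j <= M)%nat /\ x = INR j / INR (S M)) \/
  (forall k, (k <= M)%nat -> sin (node M (PI * x) k) <> 0).
Proof.
  intros Hx. pose proof (INR_S_pos M) as HN. pose proof PI_RGT_0 as HPI.
  destruct (Classical_Prop.classic
              (exists j, (j <= M)%nat /\ x = INR j / INR (S M))) as [H|H]; [now left | right].
  intros k Hk E. apply H. exists k. split; [easy|].
  apply sin_eq_0_0 in E as [z E].
  assert (Ez : x - INR k / INR (S M) = IZR z).
  { apply (Rmult_eq_reg_l PI); [|lra]. rewrite Rmult_comm in E.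
    rewrite <- (Rmult_comm (IZR z)), Rmult_comm, <- E. unfold node. field. lra. }
  assert (0 <= INR k / INR (S M) < 1).
  { split; [apply Rdiv_le_0_compat; [apply pos_INR | easy]|].
    apply Rlt_div_l; [easy|]. rewrite Rmult_1_l. apply lt_INR. lia. }
  assert (z = 0%Z); [|subst z; lra].
  assert (-1 < z)%Z by (apply lt_IZR; lra). assert (z < 1)%Z by (apply lt_IZR; lra). lia.
Qed.

Theorem propositionD1 :
  forall (M : nat) (x : R), (1 <= M)%nat ->
    Rbar_le (Finite (Rabs (vaaler M x - sawtooth x)))
            (Rbar_min (Finite (1 / 2)) (tail_bound M x)).
Proof.
  intros M x HM. pose proof (base_fp x) as Hf. pose proof PI_RGT_0 as HPI.
  pose proof (Rplus_Int_part_frac_part x) as Ex.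
  assert (HMpos : 0 < INR M) by (apply lt_0_INR; lia).
  assert (Hff : frac_part (frac_part x) = frac_part x)
    by (symmetry; apply (Int_part_frac_part_spec _ 0); lra).
  assert (HV : vaaler M x = vaaler M (frac_part x))
    by (rewrite Ex at 1; rewrite Rplus_comm; apply vaaler_add_IZR).
  assert (Hsaw : sawtooth x = sawtooth (frac_part x)) by (unfold sawtooth; now rewrite Hff).
  unfold tail_bound. rewrite HV, Hsaw, dist_nearest_int_eq. clear HV Hsaw Ex.
  set (y := frac_part x) in *. clearbody y. clear x.
  set (C := (PI ^ 4 + 10 * PI ^ 2 + 15) / (480 * PI)).
  assert (HC : 1 / 8 <= C) by apply tail_constant_ge. clearbody C.
  assert (Htail : y <> 0 -> 0 < 1 / (INR M ^ 3 * Rmin y (1 - y) ^ 3)).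
  { intros Hy. apply Rdiv_lt_0_compat; [lra|].
    apply Rmult_lt_0_compat; apply pow_lt; [easy | apply Rmin_pos; lra]. }
  destruct (node_zero_dec M y) as [[j [Hj Ey]]|Hs]; [lra | |].
  (* On the grid the error vanishes; this covers [y = 0], where the tail bound is infinite. *)
  - assert (Rabs (vaaler M y - sawtooth y) = 0)
      by (rewrite Ey, vaaler_eq_sawtooth_grid, Rminus_diag by easy; apply Rabs_R0).
    rewrite H. apply Rbar_min_case; [simpl; lra|].
    destruct (Req_dec_T y 0) as [|Hy]; [exact I|]. simpl Rbar_le.
    apply Rmult_le_pos; [lra | left; now apply Htail].
  - assert (Hy : y <> 0).
    { intros E. apply (Hs 0%nat); [lia|]. rewrite node_0, E, Rmult_0_r. apply sin_0. }
    assert (Esaw : sawtooth y = y - 1 / 2)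
      by (unfold sawtooth; rewrite Hff; now destruct (Req_dec_T y 0)).
    rewrite Esaw. destruct (Req_dec_T y 0) as [|_]; [easy|].
    apply Rbar_min_case; [apply vaaler_sub_le_half; auto; lra|]. simpl Rbar_le.
    assert (Hy1 : 0 < y < 1) by lra.
    set (m := Rmin y (1 - y)) in *.
    assert (Hm : 0 < m) by (apply Rmin_pos; lra).
    assert (HMN : INR M ^ 3 <= INR (S M) ^ 3)
      by (apply pow_incr; split; [lra | apply le_INR; lia]).
    assert (HM3 : 0 < INR M ^ 3) by (now apply pow_lt).
    eapply Rle_trans; [now apply vaaler_sub_le_deriv|].
    (* The estimate with [1 / 8] and [N ^ 3] is weakened twice: [N] to [M], then [1 / 8] to [C]. *)
    apply (Rle_trans _ (1 / 8 * (1 / (INR M ^ 3 * m ^ 3)))).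
    + replace (1 / 8 * (1 / (INR M ^ 3 * m ^ 3))) with (1 / m ^ 3 * / (8 * INR M ^ 3))
        by (field; lra).
      pose proof (ker_deriv_ge0 (PI * y)). pose proof (ker_deriv_ge0 (PI - PI * y)).
      apply Rmult_le_compat.
      * assert (0 < PI * y < PI) by nra. lra.
      * left. apply Rinv_0_lt_compat. lra.
      * now apply ker_deriv_sum_le.
      * apply Rinv_le_contravar; lra.
    + apply Rmult_le_compat_r; [left; now apply Htail | easy].
Qed.
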